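(* Let $\{(\mathbf{u}^k,\mathbf{y}^k)\}$ be a bounded sequence generated by Algorithm B (described in the context), for an arbitrary matrix $W\in\mathbb{R}^{m\times n}$. Define $$M:=\sup\Big\{\big\|((W^{\top})_{\mathcal{C}})^{\dagger}(-\nabla f(\mathbf{u}^k)-\beta W^{\top}W\mathbf{u}^k)\big\|_\infty\ :\ \mathcal{C}\subset[m],\ k=1,2,\dots\Big\}.$$ Suppose $\rho>\frac{mM^2}{\lambda}$. Assume that, for all sufficiently large $k$, no component $|(W\mathbf{u}^k)_i|$, $i\in[m]$, lies in the interval $$\Big(\frac{-M+\sqrt{M^2+\rho\lambda/m}}{\rho},\ \frac{M+\sqrt{M^2+2\rho(m+1)\lambda}}{\rho}\Big).$$ Then: (i) the global optimal solution $\mathbf{u}^{k+1}$ of the $\mathbf{u}$-subproblem of Algorithm B is $$\mathbf{u}^{k+1}=\big(t_kI+(\beta+\rho)W^{\top}W+A^{\top}A\big)^{-1}\big(A^{\top}\mathbf{u}_0-W^{\top}\mathbf{z}(\mathbf{u}^k,\mathbf{y}^k)+t_k\mathbf{u}^k+\rho W^{\top}\mathbf{y}^k\big);$$ (ii) for all sufficiently large $k$, a global optimal solution $\mathbf{y}^{k+1}$ of the $\mathbf{y}$-subproblem $\min_{\mathbf{y}\in\mathbb{R}^m}h(\mathbf{u}^{k+1},\mathbf{y})$ is given, for $i\in[m]$, by $$y_i^{k+1}=\begin{cases}(W\mathbf{u}^{k+1})_i, & \text{if } |(W\mathbf{u}^{k+1})_i|\ge\dfrac{M+\sqrt{M^2+2\rho(m+1)\lambda}}{\rho},\\[2mm]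 0, & \text{if } |(W\mathbf{u}^{k+1})_i|\le\dfrac{-M+\sqrt{M^2+\rho\lambda/m}}{\rho}.\end{cases}$$
   Context: Data: $W\in\mathbb{R}^{m\times n}$ arbitrary, $A\in\mathbb{R}^{p\times n}$, $\mathbf{u}_0\in\mathbb{R}^p$, $f(\mathbf{u})=\frac12\|A\mathbf{u}-\mathbf{u}_0\|^2$, constants $\lambda,\beta,\rho>0$ and $t_k>0$. $[m]=\{1,\dots,m\}$; $\|\cdot\|$ is the Euclidean norm, $\|\cdot\|_\infty$ the vector infinity norm, $\|\mathbf{y}\|_0$ the number of nonzero entries of $\mathbf{y}$; $\dagger$ denotes the Moore–Penrose pseudoinverse. For a matrix $B$ and index set $\mathcal{I}$, $B_{\mathcal{I}}$ is the submatrix of columns of $B$ indexed by $\mathcal{I}$; for a vector $\mathbf{y}$, $\mathbf{y}_{\mathcal{I}}$ is the corresponding subvector. For $(\mathbf{u},\mathbf{y})\in\mathbb{R}^n\times\mathbb{R}^m$ put $\mathcal{C}=\{i\in[m]: y_i=0\}$, $\mathcal{I}=\{i\in[m]: y_i\ne0\}$ and define $\mathbf{z}(\mathbf{u},\mathbf{y})\in\mathbb{R}^m$ by $$(\mathbf{z}(\mathbf{u},\mathbf{y}))_{\mathcal{C}}=((W^{\top})_{\mathcal{C}})^{\dagger}(-\nabla f(\mathbf{u})-\beta W^{\top}W\mathbf{u}),\qquad (\mathbf{z}(\mathbf{u},\mathbf{y}))_{\mathcal{I}}=\mathbf{0}.$$ Define $$h(\mathbf{u},\mathbf{y})=f(\mathbf{u})+\langle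 W\mathbf{u}-\mathbf{y},\mathbf{z}(\mathbf{u},\mathbf{y})\rangle+\lambda\|\mathbf{y}\|_0+\tfrac{\beta}{2}\|W\mathbf{u}\|^2+\tfrac{\rho}{2}\|W\mathbf{u}-\mathbf{y}\|^2.$$ Algorithm B: choose $\mathbf{u}^0\in\mathbb{R}^n$, set $\mathbf{y}^0=W\mathbf{u}^0$. For $k=0,1,2,\dots$: (1) ($\mathbf{u}$-subproblem) $\mathbf{u}^{k+1}=\operatorname{argmin}_{\mathbf{u}\in\mathbb{R}^n}\{f(\mathbf{u})+\langle W\mathbf{u}-\mathbf{y}^k,\mathbf{z}(\mathbf{u}^k,\mathbf{y}^k)\rangle+\frac{\beta}{2}\|W\mathbf{u}\|^2+\frac{t_k}{2}\|\mathbf{u}-\mathbf{u}^k\|^2+\frac{\rho}{2}\|W\mathbf{u}-\mathbf{y}^k\|^2\}$; (2) ($\mathbf{y}$-subproblem) $\mathbf{y}^{k+1}\in\operatorname{argmin}_{\mathbf{y}\in\mathbb{R}^m}h(\mathbf{u}^{k+1},\mathbf{y})$. *)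

(* Defs.v *)
From HB Require Import structures.
From mathcomp Require Import all_boot all_order all_algebra.
From mathcomp Require Import all_classical all_reals all_analysis.

Set Implicit Arguments.
Unset Strict Implicit.
Unset Printing Implicit Defensive.

Import Order.TTheory GRing.Theory Num.Theory.
Import numFieldNormedType.Exports.

Local Open Scope classical_set_scope.
Local Open Scope ring_scope.

(* Vectors of R^n are columns. The library norm `|v| on 'cV[R]_n is the        *)
(* maximum norm; the Euclidean norm is [norm2] below.                          *)

Section Euclidean.
Variables (R : realType) (n : nat).
Implicit Types x y : 'cV[R]_n.

Definition dot x y : R := \sum_i x i 0 * y i 0.

Definition norm2 x : R := Num.sqrt (\sum_i x i 0 ^+ 2).

Definition norm0 x : nat := #|[pred i | x i 0 != 0]|.

Definition zeros x : {set 'I_n} := [set i | x i 0 == 0]%SET.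

Definition grad (F : 'cV[R]_n -> R) x : 'cV[R]_n :=
  \col_j 'D_(delta_mx j 0) F x.

Definition argmin (F : 'cV[R]_n -> R) : set 'cV[R]_n :=
  [set x | forall x', F x <= F x'].

End Euclidean.

Section MoorePenrose.
Variables (R : realType) (m n : nat).
Implicit Types (B : 'M[R]_(m, n)) (X Y : 'M[R]_(n, m)).

Definition penrose B X : Prop :=
  [/\ B *m X *m B = B, X *m B *m X = X,
      (B *m X)^T = B *m X & (X *m B)^T = X *m B].

Definition mppinv B : 'M[R]_(n, m) := xget 0 [set X | penrose B X].

Lemma penrose_unique B X Y : penrose B X -> penrose B Y -> X = Y.
Proof.
move=> [x1 x2 x3 x4] [y1 y2 y3 y4].
have BXY : B *m X = B *m Y.
  have e : B *m X = B *m Y *m (B *m X) by rewrite mulmxA y1.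
  by rewrite -x3 e trmx_mul x3 y3 mulmxA x1.
have XBY : X *m B = Y *m B.
  have e : X *m B = X *m B *m (Y *m B) by rewrite -mulmxA (mulmxA B) y1.
  by rewrite -x4 e trmx_mul x4 y4 -mulmxA (mulmxA B) x1.
by rewrite -x2 XBY -mulmxA BXY mulmxA y2.
Qed.

End MoorePenrose.

Section MoorePenroseExistence.
Variable R : realType.

Lemma gram_unitmx m r (C : 'M[R]_(m, r)) : row_full C -> C^T *m C \in unitmx.
Proof.
move=> Cfull; rewrite -row_free_unit -kermx_eq0; apply/eqP/row_matrixP => i.
rewrite row0; set v := row i _.
have v0 : v *m (C^T *m C) = 0.
  by apply/eqP; rewrite -sub_kermx row_sub.
have vC0 : v *m C^T = 0.
  have : \sum_j (v *m C^T) 0 j ^+ 2 = 0.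
    transitivity ((v *m C^T *m (v *m C^T)^T) 0 0).
      by rewrite [RHS]mxE; apply: eq_bigr => j _; rewrite expr2 [(_ ^T) _ _]mxE.
    by rewrite trmx_mul trmxK !mulmxA -(mulmxA v) v0 mul0mx mxE.
  move/eqP; rewrite psumr_eq0; last by move=> j _; exact: sqr_ge0.
  move/allP => h; apply/rowP => j; rewrite [RHS]mxE; apply/eqP.
  by rewrite -sqrf_eq0; apply: h; rewrite mem_index_enum.
have Cfree : row_free C^T by rewrite /row_free mxrank_tr.
by apply: (row_free_inj Cfree); rewrite vC0 mul0mx.
Qed.

Lemma penrose_factor m r n (C : 'M[R]_(m, r)) (F : 'M[R]_(r, n)) :
  row_full C -> row_free F ->
  penrose (C *m F) (F^T *m invmx (F *m F^T) *m invmx (C^T *m C) *m C^T).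
Proof.
move=> Cfull Ffree.
have Cu : C^T *m C \in unitmx by exact: gram_unitmx.
have Fu : F *m F^T \in unitmx.
  rewrite -{1}[F]trmxK; apply: gram_unitmx.
  by rewrite /row_full mxrank_tr.
set P := invmx (C^T *m C); set Q := invmx (F *m F^T).
have BX : C *m F *m (F^T *m Q *m P *m C^T) = C *m P *m C^T.
  rewrite -!mulmxA; congr (_ *m _); rewrite !mulmxA.
  by rewrite mulmxV// mul1mx.
have XB : F^T *m Q *m P *m C^T *m (C *m F) = F^T *m Q *m F.
  rewrite !mulmxA -(mulmxA _ C^T C) -(mulmxA _ P (C^T *m C)).
  by rewrite mulVmx// mulmx1.
split.
- by rewrite BX !mulmxA -(mulmxA _ C^T C) -(mulmxA _ P (C^T *m C)) mulVmx// mulmx1.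
- rewrite XB !mulmxA -(mulmxA _ F F^T) -(mulmxA _ Q (F *m F^T)).
  by rewrite mulVmx// mulmx1.
- by rewrite BX !trmx_mul trmxK trmx_inv trmx_mul trmxK mulmxA.
- by rewrite XB !trmx_mul trmxK trmx_inv trmx_mul trmxK mulmxA.
Qed.

Lemma mppinvP m n (B : 'M[R]_(m, n)) : penrose B (mppinv B).
Proof.
have := penrose_factor (col_base_full B) (row_base_free B).
rewrite mulmx_base => BX; exact: (xgetI 0 (BX : [set X | penrose B X] _)).
Qed.

End MoorePenroseExistence.

Section Model.
Variables (R : realType) (m n p : nat).
Variables (W : 'M[R]_(m, n)) (A : 'M[R]_(p, n)) (u0 : 'cV[R]_p).
Variables (lambda beta rho : R).

Definition fid (u : 'cV[R]_n) : R := 2^-1 * norm2 (A *m u - u0) ^+ 2.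

Definition cols (C : {set 'I_m}) : 'M[R]_(n, #|C|) :=
  colsub (fun j : 'I_#|C| => enum_val j) W^T.

Definition zC (C : {set 'I_m}) (u : 'cV[R]_n) : 'cV[R]_#|C| :=
  mppinv (cols C) *m (- grad fid u - beta *: (W^T *m W *m u)).

(* The sum has the single term [zC C u j 0] with [enum_val j = i] when         *)
(* [i] is in [C = zeros y], and is empty otherwise.                            *)
Definition z (u : 'cV[R]_n) (y : 'cV[R]_m) : 'cV[R]_m :=
  \col_i \sum_(j < #|zeros y| | enum_val j == i) zC (zeros y) u j 0.

Definition h (u : 'cV[R]_n) (y : 'cV[R]_m) : R :=
  fid u + dot (W *m u - y) (z u y) + lambda * (norm0 y)%:R
  + beta / 2 * norm2 (W *m u) ^+ 2 + rho / 2 * norm2 (W *m u - y) ^+ 2.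

Definition usub (t : R) (uk : 'cV[R]_n) (yk : 'cV[R]_m) (u : 'cV[R]_n) : R :=
  fid u + dot (W *m u - yk) (z uk yk) + beta / 2 * norm2 (W *m u) ^+ 2
  + t / 2 * norm2 (u - uk) ^+ 2 + rho / 2 * norm2 (W *m u - yk) ^+ 2.

Definition algorithmB (t : nat -> R) (u : nat -> 'cV[R]_n)
    (y : nat -> 'cV[R]_m) : Prop :=
  [/\ y 0%N = W *m u 0%N,
      forall k, argmin (usub (t k) (u k) (y k)) (u k.+1)
    & forall k, argmin (h (u k.+1)) (y k.+1)].

Definition supM (u : nat -> 'cV[R]_n) : R :=
  sup [set r | exists C : {set 'I_m}, exists2 k, (1 <= k)%N & r = `|zC C (u k)|].

Definition lower (M : R) : R :=
  (- M + Num.sqrt (M ^+ 2 + rho * lambda / m%:R)) / rho.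

Definition upper (M : R) : R :=
  (M + Num.sqrt (M ^+ 2 + 2 * rho * (m.+1)%:R * lambda)) / rho.

Definition umat (t : R) : 'M[R]_n :=
  t%:M + (beta + rho) *: (W^T *m W) + A^T *m A.

Definition urhs (t : R) (uk : 'cV[R]_n) (yk : 'cV[R]_m) : 'cV[R]_n :=
  A^T *m u0 - W^T *m z uk yk + t *: uk + rho *: (W^T *m yk).

End Model.

(* Main.v *)
(* The u-subproblem is a quadratic whose Hessian t I + (beta+rho) W^T W + A^T A *)
(* dominates t I, so its only minimizer solves the normal equations. For (ii), *)
(* the multiplier z(u, y) depends on y only through its zero set and vanishes  *)
(* off it, so h(u, .) splits into one term per coordinate, once that set is    *)
(* fixed. Boundedness makes M finite, hence |z_i| <= M for every zero set. At  *)
(* |(W u)_i| below the lower threshold a zero coordinate costs at most         *)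
(* lambda/(2m), at or above the upper one at least (m+1) lambda, and never     *)
(* less than -lambda/(2m) since rho > m M^2 / lambda; the cost of a nonzero    *)
(* coordinate is at least lambda. Comparing coordinatewise, hard thresholding  *)
(* beats every other support.                                                  *)

Require Import Defs.
From HB Require Import structures.
From mathcomp Require Import all_boot all_order all_algebra.
From mathcomp Require Import all_classical all_reals all_analysis.
From mathcomp Require Import ring lra.

Set Implicit Arguments.
Unset Strict Implicit.
Unset Printing Implicit Defensive.

Import Order.TTheory GRing.Theory Num.Theory.
Import numFieldNormedType.Exports.

Local Open Scope classical_set_scope.
Local Open Scope ring_scope.

(** For (i), [usubD] is an exact second-order expansion of the u-objective; coercivity of its
    Hessian makes the critical point the only minimizer ([argmin_usub]). For (ii), [h_separable]
    leaves one coupling between coordinates: at a zero coordinate, [z] depends on the whole zero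
    set. [norm_z_le] and [norm_zC_le_supM] bound it by M along the iterates, whatever that set is.
    With e = lambda/m, passing to another zero set costs at least lambda - e where it changes and
    saves at most e elsewhere, so the net cost is at least lambda - m e = 0
    ([argmin_h_hard_threshold]). *)

(** * Inner products and Euclidean norms *)

Section DotProduct.
Variable R : realType.

Lemma dotE n (x y : 'cV[R]_n) : dot x y = (x^T *m y) 0 0.
Proof. by rewrite mxE; apply: eq_bigr => i _; rewrite mxE. Qed.

Lemma dotC n (x y : 'cV[R]_n) : dot x y = dot y x.
Proof. by apply: eq_bigr => i _; rewrite mulrC. Qed.

Lemma dotDr n (x y y' : 'cV[R]_n) : dot x (y + y') = dot x y + dot x y'.
Proof. by rewrite !dotE mulmxDr mxE. Qed.

Lemma dotNr n (x y : 'cV[R]_n) : dot x (- y) = - dot x y.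
Proof. by rewrite !dotE mulmxN mxE. Qed.

Lemma dotZr n a (x y : 'cV[R]_n) : dot x (a *: y) = a * dot x y.
Proof. by rewrite !dotE -scalemxAr mxE. Qed.

Lemma dotDl n (x x' y : 'cV[R]_n) : dot (x + x') y = dot x y + dot x' y.
Proof. by rewrite dotC dotDr dotC (dotC y). Qed.

Lemma dotZl n a (x y : 'cV[R]_n) : dot (a *: x) y = a * dot x y.
Proof. by rewrite dotC dotZr dotC. Qed.

Lemma dot_mulmxl m n (B : 'M[R]_(m, n)) x y : dot (B *m x) y = dot x (B^T *m y).
Proof. by rewrite !dotE trmx_mul mulmxA. Qed.

Lemma dot_delta n (x : 'cV[R]_n) j : dot (delta_mx j 0) x = x j 0.
Proof.
rewrite /dot (bigD1 j)//= big1 ?addr0; last first.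
  by move=> i /negPf ij; rewrite mxE ij mul0r.
by rewrite mxE !eqxx mul1r.
Qed.

Lemma sqr_norm2 n (x : 'cV[R]_n) : norm2 x ^+ 2 = \sum_i x i 0 ^+ 2.
Proof. by rewrite sqr_sqrtr// sumr_ge0// => i _; exact: sqr_ge0. Qed.

Lemma norm2_dot n (x : 'cV[R]_n) : norm2 x ^+ 2 = dot x x.
Proof. by rewrite sqr_norm2; apply: eq_bigr => i _; rewrite expr2. Qed.

Lemma sqr_norm2_eq0 n (x : 'cV[R]_n) : norm2 x ^+ 2 = 0 -> x = 0.
Proof.
rewrite sqr_norm2 => /eqP; rewrite psumr_eq0; last by move=> i _; exact: sqr_ge0.
move=> /allP x0; apply/colP => i; rewrite mxE; apply/eqP.
by rewrite -sqrf_eq0; apply: x0; rewrite mem_index_enum.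
Qed.

Lemma sqr_norm2D n (x d : 'cV[R]_n) :
  norm2 (x + d) ^+ 2 = norm2 x ^+ 2 + 2 * dot d x + norm2 d ^+ 2.
Proof. by rewrite !norm2_dot dotDl !dotDr (dotC x d); ring. Qed.

End DotProduct.

(** * Estimates in the maximum norm *)

Section MaxNorm.
Variable R : realType.

Lemma norm_entry n (x : 'cV[R]_n) i : `|x i 0| <= `|x|.
Proof.
rewrite [leRHS]/Num.Def.normr/= mx_normrE.
exact: (le_bigmax _ (fun ij : 'I_n * 'I_1 => `|x ij.1 ij.2|) (i, 0)).
Qed.

Lemma norm_le_entries n (x : 'cV[R]_n) c :
  0 <= c -> (forall i, `|x i 0| <= c) -> `|x| <= c.
Proof.
move=> c0 xc; rewrite [leLHS]/Num.Def.normr/= mx_normrE.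
by apply: bigmax_le => // -[i j] _ /=; rewrite ord1.
Qed.

(** A crude operator bound: it only serves to show that the supremum M is finite. *)
Lemma norm_mulmx_le m n (B : 'M[R]_(m, n)) (x : 'cV[R]_n) :
  `|B *m x| <= (\sum_i \sum_j `|B i j|) * `|x|.
Proof.
apply: norm_le_entries => [|i].
  by rewrite mulr_ge0// sumr_ge0// => i _; rewrite sumr_ge0.
rewrite mxE (le_trans (ler_norm_sum _ _ _))//.
rewrite (bigD1 i)//= mulrDl ler_wpDr//.
  by rewrite mulr_ge0// sumr_ge0// => k _; rewrite sumr_ge0.
rewrite mulr_suml ler_sum// => j _.
by rewrite normrM ler_wpM2l// norm_entry.
Qed.

End MaxNorm.

(** * Expansion and gradient of the data term *)

Section DataTerm.
Variables (R : realType) (n p : nat) (A : 'M[R]_(p, n)) (u0 : 'cV[R]_p).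

Lemma fidD (x d : 'cV[R]_n) : fid A u0 (x + d) =
  fid A u0 x + dot d (A^T *m (A *m x - u0)) + 2^-1 * norm2 (A *m d) ^+ 2.
Proof.
rewrite /fid (mulmxDr A) (addrAC (A *m x)) sqr_norm2D dot_mulmxl.
by field.
Qed.

Lemma grad_fid x : grad (fid A u0) x = A^T *m (A *m x - u0).
Proof.
apply/colP => j; rewrite mxE /derive.
set v := delta_mx j 0; set g := A^T *m _; set q := norm2 (A *m v) ^+ 2.
apply: cvg_lim => //.
(* By [fidD], the difference quotient along the j-th unit vector is exactly this affine function of
   s. *)
have : (g j 0 + s * (2^-1 * q)) @[s --> (0 : R)^'] --> g j 0.
  rewrite -[X in _ --> X]addr0 -[X in _ + X](mul0r (2^-1 * q)).
  apply: cvgD; first exact: cvg_cst.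
  apply: cvgM; last exact: cvg_cst.
  exact: nbhs_dnbhs.
apply: cvg_trans; apply: near_eq_cvg; near=> s.
have s0 : s != 0 by near: s; exact: nbhs_dnbhs_neq.
rewrite /= (addrC (s *: v)) fidD -/g dotZl dot_delta -scalemxAr norm2_dot dotZl dotZr.
rewrite -norm2_dot -/q /GRing.scale/=.
by field.
Unshelve. all: by end_near. Qed.

End DataTerm.

(** * The u-subproblem *)

Section UpdateU.
Variables (R : realType) (m n p : nat).
Variables (W : 'M[R]_(m, n)) (A : 'M[R]_(p, n)) (u0 : 'cV[R]_p).
Variables (beta rho t : R) (uk : 'cV[R]_n) (yk : 'cV[R]_m).
Hypotheses (beta_gt0 : 0 < beta) (rho_gt0 : 0 < rho) (t_gt0 : 0 < t).

Let H := umat W A beta rho t.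
Let r := urhs W A u0 beta rho t uk yk.

Lemma dot_umat d x : dot d (H *m x) =
  t * dot d x + (beta + rho) * dot (W *m d) (W *m x) + dot (A *m d) (A *m x).
Proof.
rewrite /H /umat !mulmxDl mul_scalar_mx -scalemxAl -!mulmxA !dotDr !dotZr.
by rewrite !dot_mulmxl.
Qed.

Lemma umat_coercive d : t * norm2 d ^+ 2 <= dot d (H *m d).
Proof.
rewrite dot_umat -!norm2_dot -addrA ler_wpDr// addr_ge0 ?sqr_ge0//.
by rewrite mulr_ge0 ?sqr_ge0 ?ltW ?addr_gt0.
Qed.

Lemma umat_unit : H \in unitmx.
Proof.
(* [kermx] is a left kernel, hence the transpose; coercivity kills every kernel vector. *)
rewrite -unitmx_tr -row_free_unit -kermx_eq0; apply/eqP/row_matrixP => i.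
rewrite row0; set v := row i _.
have Hv0 : H *m v^T = 0.
  apply: trmx_inj; rewrite trmx_mul trmxK trmx0.
  by apply/eqP; rewrite -sub_kermx row_sub.
apply: trmx_inj; rewrite trmx0; apply: sqr_norm2_eq0; apply/eqP.
have := umat_coercive v^T; rewrite Hv0 -[0 as X in dot _ X](scale0r 0) dotZr mul0r.
by rewrite pmulr_rle0// eq_le sqr_ge0 andbT.
Qed.

(** Exact Taylor formula: the gradient at x is [H *m x - r] and the Hessian is [H]. *)
Lemma usubD (x d : 'cV[R]_n) : usub W A u0 beta rho t uk yk (x + d) =
  usub W A u0 beta rho t uk yk x + dot d (H *m x - r) + 2^-1 * dot d (H *m d).
Proof.
rewrite /usub fidD (mulmxDr W) (addrAC x) (addrAC (W *m x)).
rewrite dotDl !sqr_norm2D /r /urhs !(dotDr, dotNr, dotZr, mulmxDr, mulmxN).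
rewrite (dot_umat d x) (dot_umat d d) -!norm2_dot !dot_mulmxl.
by field.
Qed.

Lemma argmin_usub : argmin (usub W A u0 beta rho t uk yk) = [set invmx H *m r].
Proof.
set x := invmx H *m r.
(* Expanding around the solution of [H *m x = r] removes the linear term. *)
have usubE v : usub W A u0 beta rho t uk yk v =
    usub W A u0 beta rho t uk yk x + 2^-1 * dot (v - x) (H *m (v - x)).
  rewrite -{1}(subrKC x v) usubD mulKVmx ?umat_unit// subrr.
  by rewrite -[0 as X in dot _ X](scale0r 0) dotZr mul0r addr0.
have ge0 d : 0 <= dot d (H *m d).
  by rewrite (le_trans _ (umat_coercive d))// mulr_ge0 ?sqr_ge0 ?ltW.
apply/seteqP; split => [v vmin|_ -> v] /=; last first.
  by rewrite (usubE v) ler_wpDr// mulr_ge0 ?invr_ge0 ?ler0n.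
have := vmin x; rewrite (usubE v) gerDl pmulr_rle0 ?invr_gt0 ?ltr0n// => dle0.
apply/eqP; rewrite -subr_eq0; apply/eqP/sqr_norm2_eq0/eqP.
rewrite eq_le sqr_ge0 andbT -(pmulr_rle0 _ t_gt0).
exact: le_trans (umat_coercive _) dle0.
Qed.

End UpdateU.

(** * Bounds on the multiplier and splitting of h *)

Section MultiplierBound.
Variables (R : realType) (m n p : nat).
Variables (W : 'M[R]_(m, n)) (A : 'M[R]_(p, n)) (u0 : 'cV[R]_p) (beta : R).

Lemma zC_affine (C : {set 'I_m}) x : zC W A u0 beta C x =
  mppinv (cols W C) *m (A^T *m u0 - (A^T *m A + beta *: (W^T *m W)) *m x).
Proof.
rewrite /zC grad_fid; congr (_ *m _).
by rewrite mulmxBr opprB -addrA mulmxDl scalemxAl opprD !mulmxA.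
Qed.

(** A [sup] dominates its set only when the set is bounded above. Here [zC] is affine in u for each
    fixed index set, so bounded iterates give such a bound. *)
Lemma norm_zC_le_supM (u : nat -> 'cV[R]_n) K (C : {set 'I_m}) k :
  (forall k, `|u k| <= K) -> (1 <= k)%N ->
  `|zC W A u0 beta C (u k)| <= supM W A u0 beta u.
Proof.
move=> uK k1.
have K0 : 0 <= K := le_trans (normr_ge0 _) (uK 0%N).
pose N a b (B : 'M[R]_(a, b)) := \sum_i \sum_j `|B i j|.
have N0 a b (B : 'M[R]_(a, b)) : 0 <= N _ _ B.
  by rewrite /N sumr_ge0// => i _; rewrite sumr_ge0.
pose q := A^T *m u0; pose Q := A^T *m A + beta *: (W^T *m W).
pose c D := N _ _ (mppinv (cols W D)) * (`|q| + N _ _ Q * K).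
have c0 D : 0 <= c D by rewrite mulr_ge0 ?addr_ge0 ?mulr_ge0.
apply: ub_le_sup; last by exists C, k.
(* Summing the nonnegative [c D] over the finitely many index sets gives a bound uniform in D. *)
exists (\sum_D c D) => _ [D [l _ ->]]; apply: (@le_trans _ _ (c D)).
  rewrite zC_affine (le_trans (norm_mulmx_le _ _))// ler_wpM2l// ?N0//.
  rewrite (le_trans (ler_normB _ _))// lerD2l.
  by rewrite (le_trans (norm_mulmx_le _ _))// ler_wpM2l// ?N0.
by rewrite (bigD1 D)//= ler_wpDr// sumr_ge0.
Qed.

Lemma z_zeros x (y y' : 'cV[R]_m) :
  zeros y = zeros y' -> z W A u0 beta x y = z W A u0 beta x y'.
Proof. by rewrite /z => ->. Qed.

Lemma z_nonzero x (y : 'cV[R]_m) i : y i 0 != 0 -> z W A u0 beta x y i 0 = 0.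
Proof.
move=> /negPf yi; rewrite mxE big_pred0// => j; apply/negP => /eqP ji.
by have := enum_valP j; rewrite ji inE yi.
Qed.

Lemma norm_z_le x (y : 'cV[R]_m) i :
  `|z W A u0 beta x y i 0| <= `|zC W A u0 beta (zeros y) x|.
Proof.
have [yi|yi] := boolP (i \in zeros y); last first.
  by rewrite z_nonzero ?normr0//; rewrite inE in yi.
rewrite mxE (big_pred1 (enum_rank_in yi i)) ?norm_entry// => j /=.
apply/eqP/eqP => [ji|->]; last by rewrite enum_rankK_in.
by apply: enum_val_inj; rewrite enum_rankK_in.
Qed.

End MultiplierBound.

Lemma h_separable (R : realType) m n p (W : 'M[R]_(m, n)) (A : 'M[R]_(p, n)) u0
    lambda beta rho x y :
  h W A u0 lambda beta rho x y =
  fid A u0 x + beta / 2 * norm2 (W *m x) ^+ 2 +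
  \sum_i (if y i 0 == 0
          then (W *m x) i 0 * z W A u0 beta x y i 0 + rho / 2 * (W *m x) i 0 ^+ 2
          else lambda + rho / 2 * ((W *m x) i 0 - y i 0) ^+ 2).
Proof.
have norm0E : lambda * (norm0 y)%:R = \sum_i (if y i 0 == 0 then 0 else lambda).
  rewrite /norm0 -sum1_card natr_sum mulr_sumr big_mkcond/=.
  by apply: eq_bigr => i _; rewrite inE mulr1; case: eqP.
rewrite /h norm0E (sqr_norm2 (W *m x - y)) mulr_sumr /dot.
transitivity (fid A u0 x + beta / 2 * norm2 (W *m x) ^+ 2 +
  \sum_i ((W *m x - y) i 0 * z W A u0 beta x y i 0 +
    (if y i 0 == 0 then 0 else lambda) + rho / 2 * (W *m x - y) i 0 ^+ 2)).
  by rewrite !big_split/=; ring.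
congr (_ + _); apply: eq_bigr => i _.
have -> : (W *m x - y) i 0 = (W *m x) i 0 - y i 0 by rewrite !mxE.
case: eqVneq => [->|yi]; first by rewrite subr0 addr0.
by rewrite z_nonzero// mulr0 add0r.
Qed.

(** * Inequalities at the two thresholds *)

Section Thresholds.
Variables (R : realType) (m : nat) (lambda rho M : R).
Hypotheses (lambda_gt0 : 0 < lambda) (rho_gt0 : 0 < rho).
Hypotheses (M_ge0 : 0 <= M) (m_gt0 : (0 < m)%N).

Let mR_gt0 : 0 < m%:R :> R. Proof. by rewrite ltr0n. Qed.

(* [lower] is the positive root of rho/2 s^2 + M s = lambda/(2m). *)
Lemma below_lower s : 0 <= s -> s <= lower m lambda rho M ->
  rho / 2 * s ^+ 2 + M * s <= lambda / m%:R / 2.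
Proof.
move=> s0; rewrite /lower; set D := _ + rho * lambda / _.
have D0 : 0 <= D by rewrite addr_ge0 ?sqr_ge0// ltW// divr_gt0// mulr_gt0.
rewrite ler_pdivlMr// addrC lerBrDl => sD.
have : (M + s * rho) ^+ 2 <= D.
  by rewrite -(sqr_sqrtr D0) lerXn2r// nnegrE ?sqrtr_ge0// addr_ge0// mulr_ge0// ltW.
rewrite /D -mulrA => le; rewrite -(ler_pM2l rho_gt0); nra.
Qed.

(* [upper] is the positive root of rho/2 s^2 - M s = (m+1) lambda. *)
Lemma above_upper s : upper m lambda rho M <= s ->
  m.+1%:R * lambda <= rho / 2 * s ^+ 2 - M * s.
Proof.
rewrite /upper; set D := _ + 2 * rho * _ * _.
have D0 : 0 <= D by rewrite addr_ge0 ?sqr_ge0// ltW// !mulr_gt0.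
rewrite ler_pdivrMr// -lerBrDl => sD.
have : D <= (s * rho - M) ^+ 2.
  rewrite -(sqr_sqrtr D0) lerXn2r// nnegrE ?sqrtr_ge0//.
  exact: le_trans (sqrtr_ge0 _) sD.
rewrite /D => le; rewrite -(ler_pM2l rho_gt0); nra.
Qed.

(** Keeps the two cases of the thresholding formula disjoint. Under the roots, rho lambda/m is at
    most rho lambda, which is below 2 rho (m+1) lambda. *)
Lemma lower_lt_upper : lower m lambda rho M < upper m lambda rho M.
Proof.
have b0 : 0 < rho * lambda by rewrite mulr_gt0.
rewrite /lower /upper ltr_pM2r ?invr_gt0// ler_ltD//; first by rewrite (le_trans _ M_ge0)// oppr_le0.
rewrite ltr_sqrt; last by rewrite ltr_wpDl ?sqr_ge0// !mulr_gt0.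
rewrite ltrD2l (@le_lt_trans _ _ (rho * lambda))//.
  by rewrite ler_pdivrMr// ler_peMr ?ler1n// ltW.
have : 1 <= m.+1%:R :> R by rewrite ler1n.
nra.
Qed.

Lemma upper_gt0 : 0 < upper m lambda rho M.
Proof.
by rewrite divr_gt0// ltr_wpDl// sqrtr_gt0 ltr_wpDl ?sqr_ge0// !mulr_gt0.
Qed.

End Thresholds.

(** * Optimality of hard thresholding *)

Section UpdateY.
Variables (R : realType) (m n p : nat).
Variables (W : 'M[R]_(m, n)) (A : 'M[R]_(p, n)) (u0 : 'cV[R]_p).
Variables (lambda beta rho M : R) (x : 'cV[R]_n).
Hypotheses (lambda_gt0 : 0 < lambda) (rho_gt0 : 0 < rho).
Hypothesis zM : forall C, `|zC W A u0 beta C x| <= M.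
Hypothesis rho_gt : m%:R * M ^+ 2 / lambda < rho.

Let w := W *m x.

Hypothesis gap : forall i,
  `|w i 0| \notin `]lower m lambda rho M, upper m lambda rho M[.

Definition hard_threshold : 'cV[R]_m :=
  \col_i (if upper m lambda rho M <= `|w i 0| then w i 0 else 0).

Let M_ge0 : 0 <= M. Proof. exact: le_trans (normr_ge0 _) (zM finset.set0). Qed.

Lemma hard_threshold_eq0 i : (0 < m)%N ->
  (hard_threshold i 0 == 0) = ~~ (upper m lambda rho M <= `|w i 0|).
Proof.
move=> m0; rewrite mxE; case: ifP; rewrite ?eqxx// => wi.
by apply/negbTE; rewrite -normr_gt0 (lt_le_trans _ wi)// upper_gt0.
Qed.

Lemma mul_z_bounds y i :
  - (M * `|w i 0|) <= w i 0 * z W A u0 beta x y i 0 <= M * `|w i 0|.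
Proof.
rewrite -ler_norml normrM mulrC ler_wpM2r//.
exact: le_trans (norm_z_le _ _ _ _ _ _ _) (zM _).
Qed.

(* Against any competitor with another zero set, each coordinate of [h] loses *)
(* at most lambda/m, and a coordinate where the zero sets differ gains at      *)
(* least lambda - lambda/m, which pays for the losses of all the others.       *)
Lemma argmin_h_hard_threshold :
  argmin (h W A u0 lambda beta rho x) hard_threshold.
Proof.
move=> y /=; set yT := hard_threshold.
rewrite !h_separable lerD2l -/w.
(* Equal zero sets give equal multipliers, and [yT] has zero residual on its support. *)
have [eqz|/eqP neqz] := eqVneq (zeros yT) (zeros y).
  rewrite (z_zeros _ _ _ _ _ eqz) ler_sum// => i _.
  have <- : (yT i 0 == 0) = (y i 0 == 0) by have := eqz => /setP/(_ i); rewrite !inE.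
  case: ifP => // yTi; move: yTi; rewrite /yT mxE; case: ifP; rewrite ?eqxx// => _ _.
  by rewrite subrr expr0n mulr0 addr0 lerDl mulr_ge0 ?sqr_ge0// divr_ge0// ltW.
have [i0 yi0] : exists i, (yT i 0 == 0) != (y i 0 == 0).
  apply/existsP; apply: contra_notT neqz => /existsPn e.
  by apply/setP => i; rewrite !inE; have := e i; rewrite negbK => /eqP.
have m0 : (0 < m)%N by exact: leq_ltn_trans (ltn_ord i0).
have mR0 : 0 < m%:R :> R by rewrite ltr0n.
rewrite -subr_ge0 -sumrB.
set F := (X in \sum_i X i).
pose e := lambda / m%:R.
have e0 : 0 < e by rewrite divr_gt0.
have me : m%:R * e = lambda by rewrite mulrC divfK// gt_eqF.
have Me : M ^+ 2 < rho * e.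
  by rewrite /e mulrA ltr_pdivlMr// mulrC -ltr_pdivrMr.
(* Complete the square: the minimum is -M^2/(2 rho), and [Me] bounds it. *)
have rE s : rho / 2 * s ^+ 2 - M * s >= - (e / 2).
  by rewrite -(ler_pM2l rho_gt0); have := sqr_ge0 (rho * s - M); nra.
(* If both entries vanish, the two costs lie between -e/2 and e/2, hence the loss e. *)
have key i : (if (yT i 0 == 0) != (y i 0 == 0) then lambda else 0) - e <= F i.
  rewrite /F hard_threshold_eq0//.
  have /andP[l1 _] := mul_z_bounds y i; have /andP[_ l2] := mul_z_bounds yT i.
  have q0 : 0 <= rho / 2 * (w i 0 - y i 0) ^+ 2.
    by rewrite mulr_ge0 ?sqr_ge0// divr_ge0// ltW.
  have sq : w i 0 ^+ 2 = `|w i 0| ^+ 2 by rewrite real_normK ?num_real.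
  have r1 := rE `|w i 0|.
  case: (lerP (upper m lambda rho M)) => /= wi.
    have := above_upper lambda_gt0 rho_gt0 wi.
    have -> : yT i 0 = w i 0 by rewrite mxE wi.
    rewrite subrr expr0n mulr0 addr0 -(natr1 m) mulrDl mul1r sq.
    have : lambda <= m%:R * lambda by rewrite ler_peMl ?ler1n// ltW.
    by case: (eqVneq (y i 0) 0) => _ /=; lra.
  have wl : `|w i 0| <= lower m lambda rho M.
    by have := gap i; rewrite in_itv/= wi andbT -leNgt.
  have := below_lower lambda_gt0 rho_gt0 M_ge0 m0 (normr_ge0 _) wl.
  rewrite -/e sq.
  by case: (eqVneq (y i 0) 0) => _ /=; lra.
apply: le_trans (ler_sum _ (fun i _ => key i)).
rewrite sumrB sumr_const card_ord -[e *+ m]mulr_natl me subr_ge0.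
rewrite (bigD1 i0)//= yi0 lerDl sumr_ge0// => i _.
by case: ifP => // _; exact: ltW.
Qed.

End UpdateY.

Theorem theorem3p2 (R : realType) (m n p : nat)
    (W : 'M[R]_(m, n)) (A : 'M[R]_(p, n)) (u0 : 'cV[R]_p)
    (lambda beta rho : R) (t : nat -> R)
    (u : nat -> 'cV[R]_n) (y : nat -> 'cV[R]_m) (M : R)
    (lambda_gt0 : 0 < lambda) (beta_gt0 : 0 < beta) (rho_gt0 : 0 < rho)
    (t_gt0 : forall k, 0 < t k)
    (uyB : algorithmB W A u0 lambda beta rho t u y)
    (uy_bounded : bounded_fun (fun k => (u k, y k)))
    (ME : M = supM W A u0 beta u)
    (rho_gt : m%:R * M ^+ 2 / lambda < rho)
    (gap : \forall k \near \oo, forall i : 'I_m,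
       `|(W *m u k) i 0| \notin `]lower m lambda rho M, upper m lambda rho M[) :
  (forall k,
     [/\ umat W A beta rho (t k) \in unitmx,
         u k.+1 = invmx (umat W A beta rho (t k)) *m
                  urhs W A u0 beta rho (t k) (u k) (y k)
       & argmin (usub W A u0 beta rho (t k) (u k) (y k)) = [set u k.+1]])
  /\
  (\forall k \near \oo, exists yk1 : 'cV[R]_m,
     (forall i : 'I_m,
        (upper m lambda rho M <= `|(W *m u k.+1) i 0| ->
           yk1 i 0 = (W *m u k.+1) i 0)
        /\
        (`|(W *m u k.+1) i 0| <= lower m lambda rho M -> yk1 i 0 = 0))
     /\ argmin (h W A u0 lambda beta rho (u k.+1)) yk1).
Proof.
have [_ uB _] := uyB.
have [K uyK] : exists K, forall k, `|(u k, y k)| <= K.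
  (* Boundedness provides a bound by every number strictly above K, hence K + 1. *)
  have [K [_ uyK]] := uy_bounded.
  by exists (K + 1) => k; apply: (uyK (K + 1)); rewrite ?ltrDl.
have uK k : `|u k| <= K.
  by apply: le_trans (uyK k); rewrite prod_normE/= le_max lexx.
have zM k C : (1 <= k)%N -> `|zC W A u0 beta C (u k)| <= M.
  by move=> k1; rewrite ME; exact: norm_zC_le_supM.
have M0 : 0 <= M := le_trans (normr_ge0 _) (zM 1%N finset.set0 isT).
split=> [k|].
  have am := argmin_usub W A u0 (u k) (y k) beta_gt0 rho_gt0 (t_gt0 k).
  have uE : u k.+1 = invmx (umat W A beta rho (t k)) *m
                     urhs W A u0 beta rho (t k) (u k) (y k).
    by have := uB k; rewrite am.
  by split; [exact: umat_unit|exact: uE|rewrite uE].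
(* The gap is used at index k+1, which is beyond N as soon as k is; the bound by M holds there since
   k+1 is at least 1. *)
case: gap => N _ gapN; exists N => // k /= Nk.
exists (hard_threshold W lambda rho M (u k.+1)); split=> [i|].
  have m0 : (0 < m)%N by exact: leq_ltn_trans (ltn_ord i).
  rewrite [hard_threshold _ _ _ _ _ i 0]mxE; split=> [->//|wi].
  by rewrite leNgt (le_lt_trans wi)//; exact: lower_lt_upper.
apply: argmin_h_hard_threshold => // [C|]; first exact: zM.
by apply: gapN => /=; exact: leqW.
Qed.
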